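(* Let $\mu=\nu$ be the uniform distribution on $[0,1]$ and let $c(x,y)=\phi(x+y)$ with $\phi:[0,2]\to\mathbb{R}$. Assume that $\phi\in\mathcal{C}^2[0,2]$ and that there is $k\in(0,2)$ such that $\phi''(x)<0$ for $x\in[0,k)$ and $\phi''(x)>0$ for $x\in(k,2]$. If $\beta\in(0,1)$ denotes the solution to $$\phi(2\beta)-\phi(\beta)=\beta\phi'(\beta),$$ then $$\Gamma(x)=\begin{cases}\beta-x,&x\in[0,\beta),\\ x,&x\in[\beta,1],\end{cases}$$ induces, via $(U,\Gamma(U))$ for a random variable $U$ uniformly distributed on $[0,1]$, an optimal $c$-coupling between $\mu$ and $\nu$.
   Context: A coupling of probability measures $\mu,\nu$ is a pair $(X_1,X_2)$ of random variables with $X_1$ distributed according to $\mu$ and $X_2$ distributed according to $\nu$. Optimality is understood in the sense of maximization: a coupling $(X_1,X_2)$ of $\mu,\nu$ is an optimal $c$-coupling if it attains $\sup\{\mathbb{E}(c(X_1,X_2)) : (X_1,X_2)\text{ a coupling of }\mu,\nu\}$. *)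

(* Defs.v *)
From HB Require Import structures.
From mathcomp Require Import all_boot all_order all_algebra.
From mathcomp Require Import all_classical all_reals all_analysis.
From mathcomp Require Import measurable_realfun.

Set Implicit Arguments.
Unset Strict Implicit.
Unset Printing Implicit Defensive.

Import Order.TTheory GRing.Theory Num.Theory.
Import numFieldNormedType.Exports.

Local Open Scope classical_set_scope.
Local Open Scope ring_scope.

Section derivative_within.
Context {R : realType}.
Implicit Types (A : set R) (f : R -> R).

(* The derivative of the restriction of f to A: one-sided at the endpoints when
   A is an interval, and independent of the values of f outside A when x is
   in A. *)
Definition derivable_within A f (x : R) :=
  cvg ((f y - f x) / (y - x) @[y --> within A x^']).

Definition derive_within A f (x : R) : R :=
  lim ((f y - f x) / (y - x) @[y --> within A x^']).

Definition C2_within A f :=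
  [/\ {in A, forall x, derivable_within A f x},
      {in A, forall x, derivable_within A (derive_within A f) x} &
      {within A, continuous (derive_within A (derive_within A f))}].

End derivative_within.

Section coupling.
Context {R : realType} {d1 d2 : measure_display}.
Context {T1 : measurableType d1} {T2 : measurableType d2}.

(* Laws are compared on measurable sets only: the value that the library's
   measures take on other sets carries no meaning. *)
Definition has_law {d d' : measure_display} {T : measurableType d}
    {T' : measurableType d'} (P : probability T R) (X : {RV P >-> T'})
    (mu : probability T' R) :=
  forall A, measurable A -> distribution P X A = mu A.

Definition is_coupling (mu : probability T1 R) (nu : probability T2 R)
    {d : measure_display} {T : measurableType d} (P : probability T R)
    (X1 : {RV P >-> T1}) (X2 : {RV P >-> T2}) :=
  has_law X1 mu /\ has_law X2 nu.

(* The underlying probability space varies with the coupling. *)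
Definition coupling_values (c : T1 -> T2 -> R)
    (mu : probability T1 R) (nu : probability T2 R) : set (\bar R) :=
  [set e | exists (d : measure_display) (T : measurableType d)
      (P : probability T R) (X1 : {RV P >-> T1}) (X2 : {RV P >-> T2}),
    is_coupling mu nu X1 X2 /\ e = 'E_P[fun w => c (X1 w) (X2 w)]%E].

Definition is_optimal_coupling (c : T1 -> T2 -> R)
    (mu : probability T1 R) (nu : probability T2 R)
    {d : measure_display} {T : measurableType d} (P : probability T R)
    (X1 : {RV P >-> T1}) (X2 : {RV P >-> T2}) :=
  is_coupling mu nu X1 X2 /\
  'E_P[fun w => c (X1 w) (X2 w)]%E = ereal_sup (coupling_values c mu nu).

End coupling.

Section uniform01.
Context {R : realType}.

(* uniform_prob is a measure on measurableTypeR R, which has the same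
   measurable sets as R but another display; this is the same set function as a
   probability on R. *)
Definition uniform01 : set R -> \bar R := uniform_prob (@ltr01 R).

Let uniform01_set0 : uniform01 set0 = 0%E.
Proof. exact: (measure0 (uniform_prob (@ltr01 R))). Qed.

Let uniform01_ge0 A : (0 <= uniform01 A)%E.
Proof. exact: (measure_ge0 (uniform_prob (@ltr01 R))). Qed.

Let uniform01_semi_sigma_additive : semi_sigma_additive uniform01.
Proof.
exact: (@measure_semi_sigma_additive _ _ _ (uniform_prob (@ltr01 R))).
Qed.

HB.instance Definition _ := isMeasure.Build _ R R uniform01
  uniform01_set0 uniform01_ge0 uniform01_semi_sigma_additive.

Let uniform01_setT : uniform01 setT = 1%E.
Proof. exact: (@probability_setT _ _ _ (uniform_prob (@ltr01 R))). Qed.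

HB.instance Definition _ :=
  Measure_isProbability.Build _ R R uniform01 uniform01_setT.

End uniform01.

Section Gamma.
Context {R : realType}.

(* Only the values on [0, 1] matter; outside, Gamma is extended by x |-> x. *)
Definition Gamma (beta x : R) : R :=
  if x \in `[0, beta[ then beta - x else x.

Let measurable_Gamma beta : measurable_fun setT (Gamma beta).
Proof.
apply: measurable_fun_ifT => //=; last exact: measurable_funB.
rewrite (_ : (fun x : R => x \in `[0, beta[) =
             (fun x => (0 <= x) && (x < beta))); last first.
  by apply/funext => x; rewrite in_itv.
by apply: measurable_and; [exact: measurable_fun_ler|exact: measurable_fun_ltr].
Qed.

HB.instance Definition _ beta :=
  isMeasurableFun.Build _ _ _ _ (Gamma beta) (measurable_Gamma beta).

End Gamma.

(* Main.v *)
(* Kantorovich duality with an explicit potential F: if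
   F x + F y >= phi (x + y) on [0, 1]^2 with equality for y = Gamma x, then
   every coupling has value at most 2 * \int F, and (U, Gamma U) attains it.
   F is affine with slope phi' beta on [0, beta) and equals phi (2 x) / 2 on
   [beta, 1]; the equation for beta makes F continuous at beta and forces
   beta < k < 2 beta.  For x, y < beta the inequality says that phi lies below
   its tangent at beta on [0, 2 beta]; for x, y >= beta it is midpoint convexity
   on [2 beta, 2]; for x < beta <= y the difference of the two sides, as a
   function of x, is nondecreasing while x + y <= k and concave afterwards, so
   it is minimal at x = 0 or at x = beta, where it is nonnegative. *)

Require Import Defs.
From mathcomp Require Import all_boot all_order all_algebra.
From mathcomp Require Import all_classical all_reals all_analysis.
From mathcomp Require Import measurable_realfun lra.

Import Order.TTheory GRing.Theory Num.Theory.
Import numFieldNormedType.Exports.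

Local Open Scope classical_set_scope.
Local Open Scope ring_scope.

(** * Derivatives relative to a closed interval and the mean value theorem *)

(** Near an interior point the constraint to [[a, b]] holds automatically, so the restricted
    punctured filter is the full one; the substitution y = h + x then gives the usual difference
    quotient. *)
Lemma derivable_within_is_derive (R : realType) (a b x : R) (f : R -> R) :
  x \in `]a, b[ -> derivable_within `[a, b] f x ->
  is_derive x 1 f (derive_within `[a, b] f x).
Proof.
move=> xab dfx.
have nbhs_ab : within `[a, b] x^' = x^'.
  apply/seteqP; split=> B; last by rewrite /within/=; apply: filterS => y + _.
  move=> wB; have /nbhs_dnbhs nab := near_in_itvoo xab.
  rewrite /within/= in wB.
  apply: (filterS2 _ _ wB nab) => y /[swap] yab; apply.
  exact: subset_itv_oo_cc.
have shiftE : h^-1 *: ((f \o shift x) (h *: (1 : R)) - f x) @[h --> 0^'] =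
    (f y - f x) / (y - x) @[y --> x^'].
  apply/funext => B; rewrite /dnbhs /within/= /fmap/=.
  rewrite [RHS](near_shift 0 x) subr0; apply: eq_near => h /=.
  rewrite -[h%:A]/(h * 1) -[_ *: _]/(_ * _) mulr1 -(subr_eq0 (h + x)) addrK.
  by rewrite [_^-1 * _]mulrC.
rewrite /derivable_within nbhs_ab in dfx.
split; first by rewrite /derivable shiftE.
by rewrite /derive /derive_within shiftE nbhs_ab.
Qed.

Lemma derivable_within_continuous (R : realType) (A : set R) (f : R -> R) :
  {in A, forall x, derivable_within A f x} -> {within A, continuous f}.
Proof.
move=> df; apply/subspace_continuousP => x Ax.
have /cvg_ex[/= l dfx] := df _ (mem_set Ax).
have dx : y - x @[y --> within A x^'] --> 0.
  rewrite -(subrr x).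
  apply: cvgB; last exact: cvg_cst.
  by apply: cvg_trans (cvg_within _) _; exact: nbhs_dnbhs.
have fx : f y @[y --> within A x^'] --> f x.
  have : f x + (f y - f x) / (y - x) * (y - x) @[y --> within A x^'] -->
      f x + l * 0.
    by apply: cvgD; [exact: cvg_cst|exact: cvgM].
  rewrite mulr0 addr0; apply: cvg_trans; apply: near_eq_cvg.
  apply: (@filterE _ (nbhs x) _ (fun y => y != x -> A y ->
    f x + (f y - f x) / (y - x) * (y - x) = f y)) => y yx Ay.
  by rewrite divfK ?subr_eq0// addrC subrK.
(* The limit [fx] avoids the point x itself; there, [f x] lies in every neighbourhood of [f x]. *)
move=> B fB.
have fxB : nbhs x (fun y => y != x -> A y -> B (f y)) := fx B fB.
apply: (@filterS _ (nbhs x) _ _ (fun y => A y -> B (f y)) _ fxB) => y yB Ay.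
have [->|/yB] := eqVneq y x; last exact.
exact: (@nbhs_singleton _ (f x) B fB).
Qed.

Lemma MVT_within (R : realType) (a b : R) (f : R -> R) :
  {in `[a, b]%classic, forall x, derivable_within `[a, b] f x} ->
  forall x y, a <= x -> x < y -> y <= b ->
  exists c, [/\ x < c, c < y & f y - f x = derive_within `[a, b] f c * (y - x)].
Proof.
move=> df x y ax xy yb.
have [|||c /[!in_itv]/= /andP[xc cy] E] :=
  @MVT R f (derive_within `[a, b] f) x y.
- exact: xy.
- move=> z; rewrite in_itv/= => /andP[xz zy].
  apply: derivable_within_is_derive.
    by rewrite in_itv/= (le_lt_trans ax xz) (lt_le_trans zy yb).
  apply: df; rewrite inE/= in_itv/=.
  by rewrite (ltW (le_lt_trans ax xz)) (ltW (lt_le_trans zy yb)).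
- apply: continuous_subspaceW (derivable_within_continuous _ _ _ df).
  by apply: subset_itv; rewrite bnd_simp.
by exists c.
Qed.

(* On [0, beta) the identity f x + f (beta - x) = phi beta and the first-order
   condition f' x = phi' (x + Gamma x) force the slope phi' beta. *)
Definition potential {R : realType} (phi p : R -> R) (beta x : R) : R :=
  if x < beta then phi beta / 2 + p beta * (x - beta / 2) else phi (2 * x) / 2.

(** * The pointwise dual inequality and its equality case, with [p] in the role of phi' *)

Section potential_theory.
Context {R : realType} {phi p : R -> R} {k beta : R}.
Hypothesis mvt : forall a b : R, 0 <= a -> a < b -> b <= 2 ->
  exists c, [/\ a < c, c < b & phi b - phi a = p c * (b - a)].
Hypothesis k_itv : 0 < k < 2.
Hypothesis p_decr : forall x y : R, 0 <= x -> x < y -> y <= k -> p y < p x.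
Hypothesis p_incr : forall x y, k <= x -> x < y -> y <= 2 -> p x < p y.
Hypothesis beta_itv : 0 < beta < 1.
Hypothesis beta_eq : phi (2 * beta) - phi beta = beta * p beta.

(** By [beta_eq] the mean slope of phi over [beta, 2 beta] is [p beta], so p takes this value again
    at some c in between. As p is strictly monotone on each side of k, k separates beta from c. *)
Lemma slope_beta : [/\ 0 < beta < 1, beta < k < 2, k < 2 * beta &
  p beta < p (2 * beta)].
Proof.
have b01 := beta_itv; have k02 := k_itv.
have bE := beta_eq.
have [|||c [bc cb E]] := mvt beta (2 * beta); try lra.
have pcE : p c = p beta.
  apply: (@mulIf _ beta); [by apply/eqP; lra | lra].
have bk : beta < k.
  by rewrite ltNge; apply/negP => kb; have := p_incr _ _ kb bc; lra.
have kc : k < c.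
  by rewrite ltNge; apply/negP => ck; have := p_decr beta c; lra.
by split; [lra|lra|lra|rewrite -pcE; apply: p_incr; lra].
Qed.

Lemma concave_tangent x t : 0 <= x <= k -> 0 <= t <= k ->
  phi x <= phi t + p t * (x - t).
Proof.
have k02 := k_itv; move=> xk tk; have [xt|tx|->] := ltgtP x t; last lra.
- have [|||c [xc ct E]] := mvt x t; try lra.
  by have := p_decr c t; nra.
- have [|||c [xc ct E]] := mvt t x; try lra.
  by have := p_decr t c; nra.
Qed.

Lemma convex_tangent x t : k <= x <= 2 -> k <= t <= 2 ->
  phi t + p t * (x - t) <= phi x.
Proof.
have k02 := k_itv; move=> xk tk; have [xt|tx|->] := ltgtP x t; last lra.
- have [|||c [xc ct E]] := mvt x t; try lra.
  by have := p_incr c t; nra.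
- have [|||c [xc ct E]] := mvt t x; try lra.
  by have := p_incr t c; nra.
Qed.

(** The tangent at s bounds phi from below at a and b. If its slope is at least v, the bound at b
    carries back to s; otherwise the bound at a does. *)
Lemma convex_below_affine a b (u v : R) s :
  k <= a -> a <= s <= b -> b <= 2 ->
  phi a <= u + v * a -> phi b <= u + v * b -> phi s <= u + v * s.
Proof.
have k02 := k_itv; move=> ka /andP[sa sb] b2 ha hb.
have := @convex_tangent a s; have := @convex_tangent b s.
move=> /(_ ltac:(lra) ltac:(lra)) Hb /(_ ltac:(lra) ltac:(lra)) Ha.
have [vp|pv] := leP v (p s).
  have := mulr_ge0 (ltac:(lra) : 0 <= p s - v) (ltac:(lra) : 0 <= b - s); lra.
have := mulr_ge0 (ltac:(lra) : 0 <= v - p s) (ltac:(lra) : 0 <= s - a); lra.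
Qed.

(** Concavity settles [0, k]. On [k, 2 beta] convexity leaves only the endpoints, and at 2 beta the
    tangent meets phi by [beta_eq]. *)
Lemma phi_le_tangent_beta s : 0 <= s <= 2 * beta ->
  phi s <= phi beta + p beta * (s - beta).
Proof.
move=> /andP[s0 s2]; have [b01 bk k2b pb] := slope_beta; have bE := beta_eq.
have [sk|ks] := leP s k; first by apply: concave_tangent; lra.
have := @concave_tangent k beta ltac:(lra) ltac:(lra) => Hk.
have := @convex_below_affine k (2 * beta) (phi beta - p beta * beta) (p beta) s.
move=> /(_ ltac:(lra) ltac:(lra) ltac:(lra) ltac:(lra) ltac:(lra)); lra.
Qed.

(** This is the dual inequality at x = 0, rewritten with [beta_eq]. Heuristically, phi (2 z) - 2 phi
    z has derivative 2 (p (2 z) - p z), which is positive for z >= beta; tangents and mean values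
    replace this derivative. *)
Lemma doubling_gap y : beta <= y <= 1 ->
  phi (2 * beta) - 2 * phi beta <= phi (2 * y) - 2 * phi y.
Proof.
have [b01 bk k2b pb] := slope_beta; have bE := beta_eq.
have low z : beta <= z <= k -> z <= 1 ->
    phi (2 * beta) - 2 * phi beta <= phi (2 * z) - 2 * phi z.
  move=> zk z1.
  have := @concave_tangent z beta ltac:(lra) ltac:(lra).
  have := @convex_tangent (2 * z) (2 * beta) ltac:(lra) ltac:(lra).
  have := mulr_ge0 (ltac:(lra) : 0 <= p (2 * beta) - p beta)
                   (ltac:(lra) : 0 <= z - beta).
  lra.
move=> yb; have [yk|ky] := leP y k; first by apply: low; lra.
apply: le_trans (low k _ _) _; try lra.
have [|||c [kc cy E]] := mvt k y; try lra.
have py2 := @convex_tangent (2 * y) y ltac:(lra) ltac:(lra).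
have pk2 := @convex_tangent (2 * k) y ltac:(lra) ltac:(lra).
have [y2k|ky2] := leP y (2 * k).
  have := @convex_tangent (2 * y) (2 * k) ltac:(lra) ltac:(lra).
  have := p_incr c (2 * k) ltac:(lra) ltac:(lra) ltac:(lra) => pc.
  have := mulr_ge0 (ltac:(lra) : 0 <= p (2 * k) - p c)
                   (ltac:(lra) : 0 <= y - k).
  lra.
(* Now k < 2k < y < 2y, and the increments of phi over the three gaps are all compared with the
   slope [p y]. *)
have [|||c' [kc' cy' E']] := mvt k (2 * k); try lra.
have pc' := p_incr c' y ltac:(lra) ltac:(lra) ltac:(lra).
have := mulr_ge0 (ltac:(lra) : 0 <= p y - p c') (ltac:(lra) : 0 <= k).
lra.
Qed.

Lemma potential_ge_mixed (x y : R) : 0 <= x < beta -> beta <= y <= 1 ->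
  phi (x + y) <= potential phi p beta x + potential phi p beta y.
Proof.
move=> xb yb; have [b01 bk k2b pb] := slope_beta; have bE := beta_eq.
rewrite /potential ifT; last lra.
rewrite ifF; last by apply/negP; lra.
have gap := doubling_gap y yb.
(* Here s stands for x + y. At s = y the bound is [gap]; up to k the slope of phi stays below
   [p beta], the slope of the right-hand side. *)
have near_y s : y <= s <= k ->
    phi s <= phi beta / 2 + p beta * (s - y - beta / 2) + phi (2 * y) / 2.
  move=> /andP[]; rewrite le_eqVlt => /predU1P[<- _|ys sk]; first lra.
  have [|||c [yc cs E]] := mvt y s; try lra.
  have pc := p_decr beta c ltac:(lra) ltac:(lra) ltac:(lra).
  have := mulr_ge0 (ltac:(lra) : 0 <= p beta - p c) (ltac:(lra) : 0 <= s - y).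
  lra.
have [xyk|kxy] := leP (x + y) k.
  by have := near_y (x + y) ltac:(lra); lra.
(* The convex range of s = x + y starts at the larger of k and y, and s = y + beta corresponds to x
   = beta, where [Hend] is midpoint convexity. *)
have := @convex_below_affine (Num.max k y) (y + beta)
  (phi beta / 2 - p beta * (y + beta / 2) + phi (2 * y) / 2) (p beta) (x + y).
have Hend : phi (y + beta) <= phi (2 * y) / 2 + phi (2 * beta) / 2.
  have := @convex_tangent (2 * y) (y + beta) ltac:(lra) ltac:(lra).
  have := @convex_tangent (2 * beta) (y + beta) ltac:(lra) ltac:(lra).
  lra.
have [ky|yk] := leP k y.
  by move=> /(_ ltac:(lra) ltac:(lra) ltac:(lra) ltac:(lra) ltac:(lra)); lra.
have := near_y k ltac:(lra) => Hk.
by move=> /(_ ltac:(lra) ltac:(lra) ltac:(lra) ltac:(lra) ltac:(lra)); lra.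
Qed.

Lemma potential_ge (x y : R) : 0 <= x <= 1 -> 0 <= y <= 1 ->
  phi (x + y) <= potential phi p beta x + potential phi p beta y.
Proof.
move=> x1 y1; have [b01 bk k2b pb] := slope_beta; have bE := beta_eq.
have [xb|bx] := ltP x beta; have [yb|by_] := ltP y beta.
- rewrite /potential xb yb.
  have := @phi_le_tangent_beta (x + y) ltac:(lra); lra.
- by apply: potential_ge_mixed; lra.
- by rewrite addrC [leRHS]addrC; apply: potential_ge_mixed; lra.
- rewrite /potential !ifF; try by apply/negP; lra.
  have := @convex_tangent (2 * x) (x + y) ltac:(lra) ltac:(lra).
  have := @convex_tangent (2 * y) (x + y) ltac:(lra) ltac:(lra).
  lra.
Qed.

Lemma potential_Gamma x : 0 <= x <= 1 ->
  phi (x + Gamma beta x) =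
  potential phi p beta x + potential phi p beta (Gamma beta x).
Proof.
have [b01 bk k2b pb] := slope_beta; have bE := beta_eq.
move=> x1; rewrite /Gamma in_itv/=; case: ifPn => [/andP[x0 xb]|xb].
  rewrite addrCA subrr addr0 /potential xb.
  case: ifPn => [xb'|]; first lra.
  (* The point 0 is sent to beta, where the other branch of the potential applies; [beta_eq] makes
     both branches agree there. *)
  rewrite -leNgt => bx; have -> : x = 0 by lra.
  rewrite subr0; lra.
rewrite /potential ifF; last first.
  by apply: contraNF xb => ->; rewrite andbT; case/andP: x1.
rewrite (_ : x + x = 2 * x); lra.
Qed.

End potential_theory.

(** * Measurability and boundedness of the potential *)

Lemma measurable_potential (R : realType) (phi p : R -> R) (beta : R) :
  0 < beta -> measurable_fun `[0 : R, 2] phi ->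
  measurable_fun `[0 : R, 1] (potential phi p beta).
Proof.
move=> b0 mphi.
have mphi2 : measurable_fun setT (phi \_ `[0 : R, 2]).
  by apply/(measurable_restrictT _ _).1 => //; exact: measurable_itv.
(* Extending phi by zero off [0, 2] makes it measurable on the whole line without changing phi (2 x)
   for x in [0, 1]. *)
apply: (@eq_measurable_fun _ _ R R _ (fun x => if x < beta
    then phi beta / 2 + p beta * (x - beta / 2)
    else (phi \_ `[0 : R, 2]) (2 * x) / 2)).
  move=> x; rewrite inE/= in_itv/= => x01; rewrite /potential patchE mem_set//=.
  by rewrite in_itv/=; lra.
apply: measurable_funTS; apply: measurable_fun_ifT => /=.
- exact: measurable_fun_ltr.
- apply: measurable_funD => //; apply: measurable_funM => //.
  exact: measurable_funB.
- apply: measurable_funM => //.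
  have mdouble : measurable_fun setT (fun x : R => 2 * x).
    exact: measurable_funM.
  exact: measurableT_comp mphi2 mdouble.
Qed.

Lemma bounded_potential (R : realType) (phi p : R -> R) (beta : R) :
  0 < beta < 1 -> {within `[0, 2], continuous phi} ->
  exists M, forall x, 0 <= x <= 1 -> `|potential phi p beta x| <= M.
Proof.
move=> b01 cphi.
have [|u _ hu] := @EVT_max R phi 0 2 _ cphi; first lra.
have [|v _ hv] := @EVT_min R phi 0 2 _ cphi; first lra.
exists (`|phi beta| + `|p beta| + `|phi u| + `|phi v|) => x x01.
rewrite /potential; case: ifPn => xb.
  apply: le_trans (ler_normD _ _) _; rewrite !normrM.
  have h2 : `|2^-1| = 2^-1 :> R by rewrite ger0_norm; lra.
  have : `|x - beta / 2| <= 1 by rewrite ler_norml; lra.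
  move=> /(ler_wpM2l (normr_ge0 (p beta))); rewrite h2.
  have := normr_ge0 (phi beta); have := normr_ge0 (phi u).
  have := normr_ge0 (phi v); lra.
have x2 : 2 * x \in `[0, 2] by rewrite in_itv/=; lra.
have := hu _ x2; have := hv _ x2.
have := ler_norm (phi u); have := ler_norm (- phi v); rewrite normrN.
have := normr_ge0 (phi beta); have := normr_ge0 (phi u).
have := normr_ge0 (phi v); have := normr_ge0 (p beta).
by rewrite ler_norml; lra.
Qed.

(** * Comparison of integrals off a null set *)

Section off_null.
Import HBNNSimple.

(** A simple function below f, set to zero on N, keeps its integral and lies below the nonnegative g
    everywhere. *)
Lemma sup_sintegral_le_off_null (d : measure_display) (T : measurableType d)
    (R : realType) (mu : {measure set T -> \bar R}) (N : set T)
    (f g : T -> \bar R) :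
  measurable N -> mu N = 0%E -> (forall x, 0 <= g x)%E ->
  (forall x, ~ N x -> f x <= g x)%E ->
  (ereal_sup [set sintegral mu h |
     h in [set h : {nnsfun T >-> R} | forall x, ((h x)%:E <= f x)%E]] <=
   ereal_sup [set sintegral mu h |
     h in [set h : {nnsfun T >-> R} | forall x, ((h x)%:E <= g x)%E]])%E.
Proof.
move=> mN muN g0 fg; apply: ge_ereal_sup => _ [h /= hf <-].
have mNC : measurable (~` N) by exact: measurableC.
pose h' := proj_nnsfun h mNC.
have h'E x : h' x = h x * (x \in ~` N)%:R by [].
have -> : sintegral mu h = sintegral mu h'.
  rewrite -!integralT_nnsfun; apply: ae_eq_integral => //.
  - exact/measurable_EFinP.
  - exact/measurable_EFinP.
  exists N; split => // x /= /not_implyP[_ hh']; apply: contrapT => Nx.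
  by apply: hh'; congr EFin; rewrite -[RHS]/(h' x) h'E mem_set// mulr1.
apply: ereal_sup_ubound; exists h' => // x; rewrite -[h' x]/(h' x) h'E.
have [Nx|Nx] := pselect (N x).
  by rewrite memNset ?mulr0//; exact.
by rewrite mem_set// mulr1; exact: le_trans (hf x) (fg x Nx).
Qed.

(* No measurability is assumed of f and g: the values of phi outside [0, 2] are
   arbitrary, so phi (X1 + X2) need not be measurable, only almost surely equal
   to a measurable function. *)
Lemma le_integral_off_null (d : measure_display) (T : measurableType d)
    (R : realType) (mu : {measure set T -> \bar R}) (N : set T)
    (f g : T -> \bar R) :
  measurable N -> mu N = 0%E -> (forall x, ~ N x -> f x <= g x)%E ->
  (\int[mu]_x f x <= \int[mu]_x g x)%E.
Proof.
move=> mN muN fg; rewrite /integral !patch_setT; apply: leeB.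
  apply: (sup_sintegral_le_off_null _ _ _ _ _ _ _ mN muN) => // x Nx.
  by rewrite !funeposE ge_max !le_max fg// lexx orbT.
apply: (sup_sintegral_le_off_null _ _ _ _ _ _ _ mN muN) => // x Nx.
by rewrite !funenegE ge_max !le_max leeN2 fg// lexx orbT.
Qed.

End off_null.

(** * The uniform law and its invariance under Gamma *)

Section uniform01_theory.
Context {R : realType}.

Lemma uniform01E (A : set R) : measurable A ->
  uniform01 A = lebesgue_measure (A `&` `[0, 1]).
Proof.
move=> mA; rewrite /uniform01 /uniform_prob integral_uniform_pdf.
rewrite (eq_integral (cst 1%E)).
  rewrite integral_cst ?mul1e//; exact: measurableI.
by move=> x; rewrite inE => -[_ /=]; rewrite in_itv/= /uniform_pdf => ->;
  rewrite subr0 invr1.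
Qed.

Lemma uniform01_setC_itv : uniform01 (~` `[0 : R, 1]%classic) = 0%E.
Proof.
by rewrite uniform01E ?setICl ?measure0//; exact: measurableC.
Qed.

(** The open left rays are closed under intersection, generate the Borel sets and exhaust the
    line. *)
Lemma uniform01_unique (mu : probability R R) :
  (forall a : R, mu `]-oo, a[%classic = uniform01 `]-oo, a[%classic) ->
  forall A, measurable A -> mu A = uniform01 A.
Proof.
move=> muE A mA.
apply: (@measure_unique _ R _ (@RGenInftyO.G R) (fun n => `]-oo, n%:R[%classic)
  _ _ _ _ mu uniform01 _ _ A mA) => //.
- exact: RGenInftyO.measurableE.
- move=> _ _ [a ->] [b ->]; exists (Num.min a b).
  by apply/seteqP; split => x /=; rewrite !in_itv/= lt_min => /andP.
- by move=> n; exists n%:R.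
- rewrite -subTset => x _; exists (Num.truncn x).+1 => //=.
  by rewrite in_itv/= truncnS_gt.
- by move=> _ [a ->]; exact: muE.
- move=> n; apply: le_lt_trans (probability_le1 _ _) (ltry _).
  exact: measurable_itv.
Qed.

(** Gamma reflects [0, beta) onto (0, beta] and fixes the rest of [0, 1]. So within [0, 1] the
    preimage of a ray ending at a is unchanged unless 0 < a <= beta, when it is (beta - a, beta), of
    the same length a as [0, a). *)
Lemma uniform01_Gamma (beta : R) (A : set R) : 0 < beta < 1 -> measurable A ->
  uniform01 (Gamma beta @^-1` A) = uniform01 A.
Proof.
move=> /andP[b0 b1] mA.
apply: (uniform01_unique (distribution uniform01 (Gamma beta))) => // a.
have mray : measurable `]-oo, a[%classic by exact: measurable_itv.
rewrite -[LHS]/(uniform01 (Gamma beta @^-1` `]-oo, a[)).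
rewrite !uniform01E//; last first.
  rewrite -[X in measurable X]setTI; exact: (measurable_funPT (Gamma beta)).
have [/andP[a0 ab]|a0b] := boolP (0 < a <= beta); last first.
  have {}a0b : a <= 0 \/ beta < a.
    by apply/orP; move: a0b; rewrite negb_and -leNgt -ltNge.
  congr (lebesgue_measure _); apply/seteqP; split => x /=;
    rewrite !in_itv/= /Gamma in_itv/=.
    move=> [+ /andP[x0 x1]]; rewrite x0 x1 /=; case: ifPn; last by split.
    by move=> xb h; split=> //; case: a0b => ?; lra.
  move=> [xa /andP[x0 x1]]; rewrite x0 x1 /=; case: ifPn; last by split.
  by move=> xb; split=> //; case: a0b => ?; lra.
rewrite (_ : _ `&` _ = `]beta - a, beta[%classic); last first.
  apply/seteqP; split => x /=; rewrite !in_itv/= /Gamma in_itv/=.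
    move=> [h /andP[x0 x1]]; move: h; rewrite x0 /=.
    by case: (ltP x beta) => xb h; lra.
  move=> h; have -> : (0 <= x) && (x < beta) by lra.
  by split; lra.
rewrite [X in _ = lebesgue_measure X](_ : _ = `[0, a[%classic); last first.
  apply/seteqP; split => x /=; rewrite !in_itv/=.
    by move=> []; lra.
  by move=> h; split; lra.
rewrite !lebesgue_measure_itv/= !lte_fin ltrBlDr ltrDl a0.
by congr (_%:E); lra.
Qed.

End uniform01_theory.

(** * Expectations under a given law, and optimality *)

Lemma bounded_expectation_law (d : measure_display) (T : measurableType d)
    (R : realType) (P : probability T R) (X : {RV P >-> R})
    (mu : probability R R) (h : R -> R) (M : R) :
  has_law X mu -> measurable_fun setT h -> (forall x, `|h x| <= M) ->
  h \o X \in Lfun P 1 /\ 'E_P[h \o X]%E = (\int[mu]_x (h x)%:E)%E.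
Proof.
move=> Xmu mh hM.
have ih : P.-integrable setT (EFin \o (h \o X)).
  apply: measurable_bounded_integrable => //.
  - exact: le_lt_trans (probability_le1 _ measurableT) (ltry _).
  - exact: measurableT_comp.
  - exists M; split; first exact: num_real.
    by move=> y My x _ /=; exact: le_trans (hM _) (ltW My).
split; first exact/Lfun1_integrable.
rewrite unlock -(@integral_distribution _ _ _ _ _ P X (EFin \o h))//; last first.
  exact/measurable_EFinP.
by apply: eq_measure_integral => A mA _; exact: Xmu.
Qed.

Lemma has_law_uniform01_off_null (d : measure_display) (T : measurableType d)
    (R : realType) (P : probability T R) (X : {RV P >-> R}) :
  has_law X uniform01 ->
  measurable (X @^-1` ~` `[0, 1]) /\ P (X @^-1` ~` `[0, 1]) = 0%E.
Proof.
move=> Xlaw; have mC : measurable (~` `[0 : R, 1]%classic).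
  exact: measurableC.
split; first by rewrite -[X in measurable X]setTI; exact: measurable_funPT.
exact: etrans (Xlaw _ mC) uniform01_setC_itv.
Qed.

Lemma has_law_uniform01_Gamma (d : measure_display) (T : measurableType d)
    (R : realType) (P : probability T R) (U : {RV P >-> R}) (beta : R) :
  0 < beta < 1 -> has_law U uniform01 ->
  has_law (P := P) (Gamma beta \o U) uniform01.
Proof.
move=> b01 Ulaw A mA; apply: etrans (uniform01_Gamma _ _ b01 mA).
by apply: Ulaw; rewrite -[X in measurable X]setTI; exact: measurable_funPT.
Qed.

Theorem theorem6 (R : realType) (phi : R -> R) (k beta : R)
  (d : measure_display) (T : measurableType d) (P : probability T R)
  (U : {RV P >-> R})
  (phi_C2 : C2_within `[0, 2] phi)
  (k_itv : 0 < k < 2)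
  (phi_concave : forall x : R, 0 <= x < k ->
     derive_within `[0, 2] (derive_within `[0, 2] phi) x < 0)
  (phi_convex : forall x : R, k < x <= 2 ->
     0 < derive_within `[0, 2] (derive_within `[0, 2] phi) x)
  (beta_itv : 0 < beta < 1)
  (beta_eq : phi (2 * beta) - phi beta =
     beta * derive_within `[0, 2] phi beta)
  (U_uniform : has_law U uniform01) :
  is_optimal_coupling (fun x y : R => phi (x + y)) uniform01 uniform01
    U (Gamma beta \o U).
Proof.
have [dphi dp _] := phi_C2.
have cphi := derivable_within_continuous _ _ _ dphi.
set p := derive_within `[0, 2] phi in phi_concave phi_convex beta_eq dp *.
have mvt := MVT_within _ _ _ _ dphi.
have p_decr x y : 0 <= x -> x < y -> y <= k -> p y < p x.
  move=> x0 xy yk.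
  have [|c [xc cy E]] := MVT_within _ _ _ _ dp x y x0 xy; first lra.
  by rewrite -subr_lt0 E nmulr_rlt0 ?subr_gt0//; apply: phi_concave; lra.
have p_incr x y : k <= x -> x < y -> y <= 2 -> p x < p y.
  move=> kx xy y2.
  have [|c [xc cy E]] := MVT_within _ _ _ _ dp x y _ xy y2; first lra.
  by rewrite -subr_gt0 E mulr_gt0 ?subr_gt0//; apply: phi_convex; lra.
have F_ge := potential_ge mvt k_itv p_decr p_incr beta_itv beta_eq.
have F_Gamma := potential_Gamma mvt k_itv p_decr p_incr beta_itv beta_eq.
(* Cutting the potential to zero outside [0, 1] gives a bounded measurable function on the whole
   line, which can be composed with any random variable. *)
pose F : R -> R := potential phi p beta \_ `[0 : R, 1].
have FE x : x \in `[0, 1] -> F x = potential phi p beta x.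
  by move=> x01; rewrite /F patchE mem_set.
have mF : measurable_fun setT F.
  apply/(measurable_restrictT _ _).1 => //; apply: measurable_potential.
    by case/andP: beta_itv.
  exact: subspace_continuous_measurable_fun.
have [M FM] : exists M, forall x, `|F x| <= M.
  have [M hM] := bounded_potential R phi p beta beta_itv cphi.
  exists M => x; rewrite /F patchE; case: ifPn => [|_].
    by rewrite inE/= in_itv/=; exact: hM.
  by rewrite normr0 (le_trans (normr_ge0 _) (hM 0 _))// lexx ler01.
pose S := (\int[uniform01]_x (F x)%:E)%E.
(* The dual value depends on the marginals only, hence is the same for all couplings. *)
have E_F d' (T' : measurableType d') (P' : probability T' R)
    (X1 X2 : {RV P' >-> R}) : is_coupling uniform01 uniform01 X1 X2 ->
    ('E_P'[((F \o X1) \+ (F \o X2))%R] = S + S)%E.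
  move=> [law1 law2].
  have [L1 E1] := bounded_expectation_law _ _ _ _ _ _ _ _ law1 mF FM.
  have [L2 E2] := bounded_expectation_law _ _ _ _ _ _ _ _ law2 mF FM.
  by rewrite expectationD// E1 E2.
have le_S d' (T' : measurableType d') (P' : probability T' R)
    (X1 X2 : {RV P' >-> R}) : is_coupling uniform01 uniform01 X1 X2 ->
    ('E_P'[fun w => phi (X1 w + X2 w)%R] <= S + S)%E.
  move=> X12; rewrite -(E_F _ _ _ _ _ X12) unlock.
  have [mN1 N1] := has_law_uniform01_off_null _ _ _ _ _ X12.1.
  have [mN2 N2] := has_law_uniform01_off_null _ _ _ _ _ X12.2.
  apply: (le_integral_off_null _ _ _ _ _ _ _ (measurableU _ _ mN1 mN2)).
    exact: null_set_setU.
  (* Off the null set both coordinates lie in [0, 1], where the dual inequality applies. *)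
  move=> w /not_orP[/contrapT w1 /contrapT w2].
  rewrite lee_fin /= !FE//.
  by apply: F_ge; [move: w1|move: w2]; rewrite /= in_itv.
have UG : is_coupling uniform01 uniform01 U (Gamma beta \o U).
  by split => //; exact: has_law_uniform01_Gamma.
(* Equality along the graph of Gamma makes this coupling reach the common upper bound. *)
have ge_S : (S + S <= 'E_P[fun w => phi (U w + Gamma beta (U w))%R])%E.
  rewrite -(E_F _ _ _ _ _ UG) unlock.
  have [mN1 N1] := has_law_uniform01_off_null _ _ _ _ _ UG.1.
  have [mN2 N2] := has_law_uniform01_off_null _ _ _ _ _ UG.2.
  apply: (le_integral_off_null _ _ _ _ _ _ _ (measurableU _ _ mN1 mN2)).
    exact: null_set_setU.
  move=> w /not_orP[/contrapT w1 /contrapT w2].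
  by rewrite lee_fin /= !FE// F_Gamma//.
split => //; apply/eqP; rewrite eq_le; apply/andP; split.
  by apply: ereal_sup_ubound; exists d, T, P, U, (Gamma beta \o U).
apply: ge_ereal_sup => _ [d' [T' [P' [X1 [X2 [X12 ->]]]]]].
exact: le_trans (le_S _ _ _ _ _ X12) ge_S.
Qed.
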